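(* For all fixed triplets of integers $r,k,q$ with $r\ge 2$, $q\ge -r+1$ and $k\ge r+q+1$ we have, as $n\to\infty$, $$\mathrm{ex}(n,\mathcal{H}^{(r)}(k,q)) = \Omega\left(n^{r-1+\frac{q+r}{k-1}}\right) = \Omega\left(n^{\frac{kr-k+q+1}{k-1}}\right).$$
   Context: An $r$-graph is an $r$-uniform hypergraph $H$ (finite vertex set $V(H)$, edge set $E(H)$, each edge an $r$-element subset of $V(H)$), simple, i.e. without multiple edges; vertices contained in no edge are allowed. A hypergraph $H_1$ is a subhypergraph of $H_2$ if $V(H_1)\subseteq V(H_2)$ and $E(H_1)\subseteq E(H_2)$ (not necessarily induced). For a family $\mathcal{F}$ of $r$-graphs, an $r$-graph is $\mathcal{F}$-free if it has no subhypergraph isomorphic to a member of $\mathcal{F}$, and $\mathrm{ex}(n,\mathcal{F})$ is the maximum number of edges in an $\mathcal{F}$-free $r$-graph on $n$ vertices. For integers $r\ge 2$, $q\ge -r+1$, $k\ge q+r+1$, $\mathcal{H}^{(r)}(k,q)$ is the family of all $r$-graphs $H$ with $|E(H)|-|V(H)|=q+1$ and $q+r+1\le |E(H)|\le k$. *)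

(* Defs.v *)
From HB Require Import structures.
From mathcomp Require Import all_boot all_order all_algebra.
From mathcomp Require Import boolp.

Set Implicit Arguments.
Unset Strict Implicit.
Unset Printing Implicit Defensive.

Import Order.TTheory GRing.Theory Num.Theory.

Local Open Scope ring_scope.

(* An r-graph is given by finite sets inside an ambient finite type [T]: its
   vertex set need not be all of [T], so that a subhypergraph may have a
   smaller vertex set. *)
Record rgraph (r : nat) (T : finType) := RGraph {
  rgraph_val :> {set T} * {set {set T}};
  _ : [forall e in rgraph_val.2, (e \subset rgraph_val.1) && (#|e| == r)]
}.

HB.instance Definition _ (r : nat) (T : finType) :=
  [isSub for @rgraph_val r T].
HB.instance Definition _ (r : nat) (T : finType) :=
  [Finite of rgraph r T by <:].

Definition vertices (r : nat) (T : finType) (H : rgraph r T) : {set T} :=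
  (val H).1.

Definition edges (r : nat) (T : finType) (H : rgraph r T) : {set {set T}} :=
  (val H).2.

Definition subhypergraph (r : nat) (T : finType) (H1 H2 : rgraph r T) : bool :=
  (vertices H1 \subset vertices H2) && (edges H1 \subset edges H2).

Definition isomorphic (r : nat) (T U : finType)
    (G : rgraph r T) (H : rgraph r U) : Prop :=
  exists2 f : {x | x \in vertices G} -> {y | y \in vertices H},
    bijective f &
    forall e : {set {x | x \in vertices G}},
      ([set val x | x in e] \in edges G) =
      ([set val (f x) | x in e] \in edges H).

Definition rfamily (r : nat) : Type := forall U : finType, rgraph r U -> Prop.

Definition family_free (r : nat) (F : rfamily r) (T : finType)
    (H : rgraph r T) : Prop :=
  forall (H' : rgraph r T) (U : finType) (G : rgraph r U),
    subhypergraph H' H -> F U G -> ~ isomorphic H' G.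

(* Every r-graph on n vertices has an isomorphic copy with vertex set 'I_n. The
   value is 0 if no r-graph on n vertices is F-free, which can happen only when
   F contains an edgeless r-graph. *)
Definition ex (r n : nat) (F : rfamily r) : nat :=
  \max_(H : rgraph r 'I_n | (vertices H == [set: 'I_n]) &&
                            `[< family_free F H >])
    #|edges H|.

Definition family_H (r k : nat) (q : int) : rfamily r :=
  fun U H =>
    #|edges H|%:Z - #|vertices H|%:Z = q + 1 /\
    q + r%:Z + 1 <= #|edges H|%:Z <= k%:Z.

(* Main.v *)
Require Import Defs.
From HB Require Import structures.
From mathcomp Require Import all_boot all_order all_algebra.
From mathcomp Require Import boolp classical_sets reals topology normedtype.
From mathcomp Require Import landau exp.
From mathcomp Require Import zify ring lra.

(** The lower bound comes from the deletion method.  Put t = q + r >= 1 and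
    d = k - 1 - t, so that the forbidden graphs are those with r + j vertices
    and j + t + 1 edges for some j <= d.  Keep each r-subset of an n-set
    independently with probability p, then delete one edge from every surviving
    forbidden configuration.  The expected number of edges left is at least
    p * 'C(n, r) minus the sum over j <= d of M n^(r+j) p^(j+t+1), where
    M = 2^(2^(r+d)) bounds the number of edge sets on a given set of at most
    r + d vertices ([deletion], [sum_overfull], [sparse_graph]).

    Take p = c n^(-d/(d+t)).  The j-th term is M p n^r times n^j p^(j+t), and
    n^j p^(j+t) <= c because the power of n in it is t (j - d)/(d + t) <= 0
    ([powR_density]).  A small c therefore makes the deleted edges at most half
    of the expected edges, and a constant times p n^r edges remain ([ex_ge]);
    the exponent r - d/(d+t) is r - 1 + (q+r)/(k-1).  The two exponents of the
    theorem are equal. *)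

Set Implicit Arguments.
Unset Strict Implicit.
Unset Printing Implicit Defensive.

Import Order.TTheory GRing.Theory Num.Theory.
Import numFieldNormedType.Exports.

Local Open Scope ring_scope.
Section FiniteCombinatorics.

(* The names of finite sets and subsets are shadowed by those of classical
   sets, and [rgraph] by the graph of a relation. *)
Import fintype boot.finset Defs.

(** * Counting vertices and edges under isomorphism *)

Lemma edge_sub (r : nat) (T : finType) (H : rgraph r T) e :
  e \in edges H -> e \subset vertices H.
Proof.
rewrite /edges /vertices; case: H => -[V E] /= HP eE.
by have /andP[] := forall_inP HP _ eE.
Qed.

Lemma edge_card (r : nat) (T : finType) (H : rgraph r T) e :
  e \in edges H -> #|e| = r.
Proof.
rewrite /edges; case: H => -[V E] /= HP eE.
by have /andP[_ /eqP] := forall_inP HP _ eE.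
Qed.

(** Edges are transported through sets of elements of the vertex subtype: every
    edge lies inside the vertex set, so it is the image of such a set, and the
    vertex bijection acts on these sets bijectively. *)
Lemma isomorphic_card (r : nat) (T U : finType) (G : rgraph r T)
    (H : rgraph r U) :
  isomorphic G H ->
  #|vertices G| = #|vertices H| /\ #|edges G| = #|edges H|.
Proof.
have card_edges (W : finType) (K : rgraph r W) : #|edges K| =
    #|[set e : {set {x | x \in vertices K}} | [set val x | x in e] \in edges K]|.
  rewrite -(card_imset _ (imset_inj val_inj)).
  apply: eq_card => e; apply/idP/imsetP => [eK | [e' + ->]]; last by rewrite inE.
  have e_val : e = [set val x | x in [set x : {x | x \in vertices K} | val x \in e]].
    apply/setP => x; apply/idP/imsetP => [xe | [y + ->]]; last by rewrite inE.
    have xK := subsetP (edge_sub eK) x xe.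
    by exists (exist _ x xK); rewrite ?inE.
  by exists [set x : {x | x \in vertices K} | val x \in e]; rewrite ?inE -?e_val.
move=> [f f_bij fP]; split.
  have := bij_eq_card f_bij; rewrite !card_sig => VGH.
  by rewrite -(eq_card (A := [pred x | x \in vertices G])) // VGH; apply: eq_card.
rewrite !card_edges -(card_imset _ (imset_inj (bij_inj f_bij))).
have [g fK gK] := f_bij.
have fgK (e : {set {y | y \in vertices H}}) : f @: (g @: e) = e.
  by rewrite -imset_comp (eq_imset (g := id)) ?imset_id.
apply: eq_card => e; rewrite !inE; apply/imsetP/idP => [[e' + ->] | eH].
  by rewrite inE fP -imset_comp.
by exists (g @: e); rewrite ?fgK // inE fP (imset_comp val f) fgK.
Qed.

(** * The deletion method *)

Section Deletion.

Variables (R : realFieldType) (T : finType) (p : R).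
Hypothesis p01 : 0 <= p <= 1.

(** The probability of the outcome [J] when each point is kept independently
    with probability [p]. *)
Definition bernoulli (J : {set T}) : R :=
  \prod_x (if x \in J then p else 1 - p).

Lemma bernoulli_ge0 J : 0 <= bernoulli J.
Proof.
case/andP: p01 => p_ge0 p_le1.
by apply: prodr_ge0 => x _; case: ifP => _ //; rewrite subr_ge0.
Qed.

(** A given set survives with probability [p ^+ #|S|]: expand the product over
    points of [p + (1 - p)], where the second summand is replaced by 0 on [S]
    so that only the outcomes containing [S] contribute. *)
Lemma sum_bernoulli (S : {set T}) :
  \sum_J bernoulli J * (S \subset J)%:R = p ^+ #|S|.
Proof.
pose G x := if x \in S then 0 else 1 - p.
transitivity (\prod_x (p + G x)); last first.
  rewrite -[RHS]mulr1 -prodr_const (bigID (mem S)) /=; congr (_ * _).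
    by apply: eq_bigr => x xS; rewrite /G xS addr0.
  by rewrite big1 // => x xS; rewrite /G (negbTE xS) addrC subrK.
rewrite bigA_distr; apply: eq_bigr => J _.
have [SJ | /subsetPn[x xS xJ]] := boolP (S \subset J).
  rewrite mulr1; apply: eq_bigr => x _; case: ifPn => // xJ.
  by rewrite /G; case: ifPn => // /(subsetP SJ); rewrite (negbTE xJ).
by rewrite mulr0 (bigD1 x) //= (negbTE xJ) /G xS mul0r.
Qed.

(** The random variable [X] counts the survivors in [A] minus the surviving
    configurations, so its mean is the left-hand side of the bound and some
    outcome [J] reaches it.  Deleting one point from each configuration that
    survives in [J] gives [B].  The configurations are indexed by [I] so that a
    union of several kinds needs no disjointness. *)
Lemma deletion (I : finType) (P : pred I) (S : I -> {set T}) (A : {set T}) :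
  (forall i, P i -> S i != set0) ->
  exists B : {set T},
    [/\ B \subset A, forall i, P i -> ~~ (S i \subset B) &
        p * #|A|%:R - \sum_(i | P i) p ^+ #|S i| <= #|B|%:R].
Proof.
move=> S_neq0.
pose X (J : {set T}) : R :=
  \sum_(x in A) ([set x] \subset J)%:R - \sum_(i | P i) (S i \subset J)%:R.
have mean : \sum_J bernoulli J * X J =
    p * #|A|%:R - \sum_(i | P i) p ^+ #|S i|.
  transitivity (\sum_J (\sum_(x in A) bernoulli J * ([set x] \subset J)%:R -
                        \sum_(i | P i) bernoulli J * (S i \subset J)%:R)).
    by apply: eq_bigr => J _; rewrite mulrBr !mulr_sumr.
  rewrite sumrB exchange_big [X in _ - X]exchange_big /=; congr (_ - _).
    under eq_bigr => x _ do rewrite sum_bernoulli cards1 expr1.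
    by rewrite sumr_const mulr_natr.
  by apply: eq_bigr => i _; rewrite sum_bernoulli.
have total : \sum_J bernoulli J = 1.
  have := sum_bernoulli set0; rewrite cards0 expr0 => <-.
  by apply: eq_bigr => J _; rewrite sub0set mulr1.
have [J _ maxJ] := @arg_maxP _ _ _ set0 xpredT X isT.
have {mean total maxJ} leX : p * #|A|%:R - \sum_(i | P i) p ^+ #|S i| <= X J.
  rewrite -mean -[X J]mul1r -total mulr_suml; apply: ler_sum => J' _.
  by rewrite ler_wpM2l ?bernoulli_ge0 //; exact: maxJ.
(* One point chosen from each surviving configuration. *)
pose D := [set x in pmap (fun i => [pick x in S i])
                         (enum [pred i | P i & S i \subset J])].
exists (A :&: J :\: D); split.
- by rewrite (subset_trans (subsetDl _ _)) ?subsetIl.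
- move=> i Pi; apply/negP => SiB.
  have [x xS] := set0Pn _ (S_neq0 i Pi).
  case xi: [pick x in S i] => [y|]; last first.
    by move: xi; case: pickP => // /(_ x); rewrite xS.
  have yS : y \in S i by move: xi; case: pickP => // z zS [<-].
  have := subsetP SiB y yS; rewrite !inE => /andP[+ _].
  rewrite mem_pmap => /negP; apply; apply/mapP; exists i => //.
  rewrite mem_enum inE Pi /=.
  by apply: subset_trans SiB _; rewrite (subset_trans (subsetDl _ _)) ?subsetIr.
- apply: le_trans leX _; rewrite /X.
  under eq_bigr do rewrite sub1set.
  rewrite -!natr_sum -!big_mkcondr /= !sum1_card lerBlDr -natrD ler_nat.
  have cD : (#|D| <= #|[pred i | P i & S i \subset J]|)%N.
    rewrite cardsE (leq_trans (card_size _)) // size_pmap cardE.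
    exact: count_size.
  have -> : #|[pred x in A | x \in J]| = #|A :&: J|.
    by apply: eq_card => x; rewrite !inE.
  rewrite -(cardsID D (A :&: J)) addnC leq_add2l.
  rewrite (leq_trans (subset_leq_card (subsetIr _ _))) // (leq_trans cD) //.
Qed.

End Deletion.

(** * Sparse graphs avoid the family *)

(** [S] is the edge set of an r-graph on [V] in which edges minus vertices is
    t - r + 1 = q + 1. *)
Definition overfull n r t j (V : {set 'I_n}) (S : {set {set 'I_n}}) : bool :=
  [&& #|V| == (r + j)%N, #|S| == (j + t).+1 &
      S \subset [set e : {set 'I_n} | e \subset V & #|e| == r]].

(** The expected number of surviving configurations with [r + j] vertices: there
    are at most [n ^ (r + j)] vertex sets, and each carries at most as many edge
    sets as there are families of its subsets. *)
Lemma sum_overfull (R : realFieldType) n r t d j (p : R) :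
  0 <= p -> (j <= d)%N ->
  \sum_(V : {set 'I_n}) \sum_(S | overfull r t j V S) p ^+ #|S| <=
  (n ^ (r + j) * 2 ^ (2 ^ (r + d)))%:R * p ^+ (j + t).+1.
Proof.
move=> p_ge0 jd; pose M := (2 ^ (2 ^ (r + d)))%N.
have inner (V : {set 'I_n}) :
    \sum_(S | overfull r t j V S) p ^+ #|S| <=
    (if #|V| == (r + j)%N then M%:R * p ^+ (j + t).+1 else 0).
  case: ifPn => [/eqP cV|cV]; last first.
    by rewrite big_pred0 // => S; rewrite /overfull (negbTE cV).
  rewrite (eq_bigr (fun=> p ^+ (j + t).+1)); last first.
    by move=> S /and3P[_ /eqP -> _].
  rewrite sumr_const -(mulr_natl (p ^+ _)) ler_wpM2r ?exprn_ge0 // ler_nat.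
  apply: (@leq_trans #|powerset (powerset V)|).
    apply/subset_leq_card/subsetP => S /and3P[_ _ SV].
    rewrite inE; apply: subset_trans SV _.
    by apply/subsetP => e; rewrite !inE => /andP[].
  by rewrite !card_powerset cV leq_exp2l // leq_exp2l // leq_add2l.
apply: le_trans (ler_sum _ (fun V _ => inner V)) _.
rewrite -big_mkcond sumr_const -(mulr_natl (_ * _)) natrM -mulrA -/M.
rewrite ler_wpM2r ?mulr_ge0 ?exprn_ge0 ?ler0n // ler_nat.
have -> : #|[pred V : {set 'I_n} | #|V| == (r + j)%N]| = 'C(n, r + j).
  by rewrite -[n in RHS]card_ord -card_draws cardsE.
have fact_gt : (0 < (r + j)`!)%N := fact_gt0 _.
rewrite (leq_trans (leq_pmulr _ fact_gt)) // bin_ffact.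
elim: (r + j)%N => // i IHi.
by rewrite ffactnSr expnSr leq_mul ?leq_subr.
Qed.

Lemma sparse_graph (R : realFieldType) n r t d (p : R) :
  0 <= p <= 1 ->
  exists E : {set {set 'I_n}},
    [/\ forall e, e \in E -> #|e| = r,
        forall j V S, (j <= d)%N -> overfull r t j V S -> ~~ (S \subset E) &
        p * 'C(n, r)%:R -
          \sum_(j < d.+1) (n ^ (r + j) * 2 ^ (2 ^ (r + d)))%:R * p ^+ (j + t).+1
          <= #|E|%:R].
Proof.
move=> p01; have [p_ge0 _] := andP p01.
pose I := ('I_d.+1 * ({set 'I_n} * {set {set 'I_n}}))%type.
pose P (i : I) := overfull r t i.1 i.2.1 i.2.2.
have [|E [EA Efree leE]] :=
    @deletion R _ p p01 I P (fun i => i.2.2) [set e : {set _} | #|e| == r].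
  by move=> [j [V S]] /and3P[_ /= /eqP cS _]; rewrite -card_gt0 cS.
exists E; split => [e /(subsetP EA)|j V S jd jVS|].
- by rewrite inE => /eqP.
- exact: (Efree (Ordinal (jd : (j < d.+1)%N), (V, S))).
apply: le_trans leE; rewrite card_draws card_ord lerD2l lerN2.
have -> : \sum_(i | P i) p ^+ #|i.2.2| =
    \sum_(j < d.+1) \sum_(V : {set 'I_n}) \sum_(S | overfull r t j V S) p ^+ #|S|.
  under [RHS]eq_bigr => j _ do rewrite pair_big_dep /=.
  by rewrite pair_big_dep; apply: eq_bigl.
apply: ler_sum => j _; apply: sum_overfull => //; exact: (ltn_ord j).
Qed.

(** A subhypergraph isomorphic to a member of the family would have the vertex
    and edge counts of that member, hence be overfull with
    j = edges - (t + 1). *)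
Lemma sparse_free n r t d (H : rgraph r 'I_n) :
  (forall j V S, (j <= d)%N -> overfull r t j V S -> ~~ (S \subset edges H)) ->
  family_free (@family_H r (d + t).+1 (t%:Z - r%:Z)) H.
Proof.
move=> sparse K U G /andP[_ KH] [GE Gk] /isomorphic_card[cV cE].
pose j := (#|edges K| - t.+1)%N.
have jd : (j <= d)%N by rewrite /j cE; lia.
suff: overfull r t j (vertices K) (edges K) by move/(sparse _ _ _ jd); rewrite KH.
apply/and3P; split; [by apply/eqP; lia | by apply/eqP; lia |].
by apply/subsetP => e eK; rewrite inE (edge_sub eK) (edge_card eK) eqxx.
Qed.

Lemma ex_sparse_ge (R : realFieldType) n r t d (p : R) :
  0 <= p <= 1 ->
  p * 'C(n, r)%:R -
    \sum_(j < d.+1) (n ^ (r + j) * 2 ^ (2 ^ (r + d)))%:R * p ^+ (j + t).+1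
    <= (ex n (@family_H r (d + t).+1 (t%:Z - r%:Z)))%:R.
Proof.
move=> /(@sparse_graph R n r t d)[E [E_r E_sparse leE]].
have HP : [forall e in ([set: 'I_n], E).2,
    (e \subset ([set: 'I_n], E).1) && (#|e| == r)].
  by apply/forall_inP => e /= /E_r ->; rewrite subsetT eqxx.
pose H : rgraph r 'I_n := RGraph HP.
apply: (le_trans leE); rewrite ler_nat.
apply: (leq_bigmax_cond (F := fun H : rgraph r 'I_n => #|edges H|) H).
rewrite eqxx /=; apply/asboolP/sparse_free; exact: E_sparse.
Qed.

End FiniteCombinatorics.

(** * Choosing the density *)

(** For [i < r] and [2 r <= n] each factor [n - i] of the falling factorial is
    at least n/2. *)
Lemma bin_ge_expn n r : (r.*2 <= n)%N -> (n ^ r <= 2 ^ r * r`! * 'C(n, r))%N.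
Proof.
move=> rn; rewrite -mulnA [(r`! * _)%N]mulnC bin_ffact.
have ffact_ge i : (i <= r)%N -> (n ^ i <= 2 ^ i * n ^_ i)%N.
  elim: i => // i IHi ir.
  rewrite expnSr ffactnSr expnSr mulnACA leq_mul ?IHi 1?ltnW //.
  by rewrite mulnBr -addnn in rn *; lia.
exact: ffact_ge.
Qed.

(** The powers of [n] add up to j - d (j + t)/(d + t) = - t (d - j)/(d + t),
    which is nonpositive, with equality at j = d: the largest forbidden graphs
    determine the density. *)
Lemma powR_density (R : realType) n t d j (c : R) :
  0 < c <= 1 -> (0 < n)%N -> (0 < t)%N -> (j <= d)%N ->
  n%:R ^+ j * (c * n%:R `^ (- (d%:R / (d + t)%:R))) ^+ (j + t) <= c.
Proof.
move=> /andP[c_gt0 c_le1] n_gt0 t_gt0 jd.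
have n1 : 1 <= n%:R :> R by rewrite ler1n.
have n0 : 0 <= n%:R :> R by rewrite ler0n.
have nn0 : n%:R != 0 :> R by rewrite pnatr_eq0; lia.
have dt0 : 0 < (d + t)%:R :> R by rewrite ltr0n addn_gt0 t_gt0 orbT.
rewrite exprMn mulrCA -powR_mulrn // -[X in _ * (_ * X)]powR_mulrn ?powR_ge0 //.
rewrite -powRrM -powRD; last by rewrite nn0 implybT.
rewrite -[leRHS]mulr1 ler_pM ?exprn_ge0 ?powR_ge0 ?(ltW c_gt0) //.
  by rewrite -[leRHS]expr1 ler_wiXn2l ?(ltW c_gt0) // addn_gt0 t_gt0 orbT.
rewrite -[leRHS](powRr0 n%:R) ler_powR //.
suff -> : j%:R + - (d%:R / (d + t)%:R) * (j + t)%:R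
    = - (t%:R * (d - j)%:R / (d + t)%:R) :> R.
  by rewrite oppr_le0 divr_ge0 ?mulr_ge0 ?ler0n // ltW.
by rewrite natrB // !natrD in dt0 *; field; lra.
Qed.

(** The deletion bound at p = c n^(-d/(d+t)): the expected number of edges is at
    least p n^r / (2^r r!), and c is chosen so that at most half of that is
    lost to deletions. *)
Lemma ex_ge (R : realType) r t d : (0 < t)%N ->
  exists2 a : R, 0 < a &
    forall n, (r.*2 <= n)%N -> (0 < n)%N ->
      a * n%:R `^ (r%:R - d%:R / (d + t)%:R) <=
      (ex n (@family_H r (d + t).+1 (t%:Z - r%:Z)))%:R.
Proof.
move=> t_gt0.
have [A AE A1] : exists2 A : R, A = (2 ^ r * r`!)%:R & 1 <= A.
  by eexists; first reflexivity; rewrite ler1n muln_gt0 expn_gt0 fact_gt0.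
have [M ME M1] : exists2 M : R, M = (2 ^ (2 ^ (r + d)))%:R & 1 <= M.
  by eexists; first reflexivity; rewrite ler1n expn_gt0.
have d1 : 1 <= d.+1%:R :> R by rewrite ler1n.
(* The d + 1 deletion terms are each at most p n^r M c, so for this c they add
   up to at most p n^r / (2 A), half of the lower bound for the main term. *)
pose c : R := (2 * A * d.+1%:R * M)^-1.
have AdM1 : 1 <= 2 * A * d.+1%:R * M.
  by rewrite !mulr_ege1 // ler1n.
have c_gt0 : 0 < c by rewrite invr_gt0 (lt_le_trans ltr01).
have c_le1 : c <= 1 by rewrite invf_le1 // (lt_le_trans ltr01).
exists (c / (2 * A)); first by rewrite divr_gt0 // mulr_gt0 // (lt_le_trans ltr01).
move=> n rn n_gt0; have n1 : 1 <= n%:R :> R by rewrite ler1n.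
have n0 : 0 <= n%:R :> R by rewrite ler0n.
pose p := c * n%:R `^ (- (d%:R / (d + t)%:R)).
have p_ge0 : 0 <= p by rewrite mulr_ge0 ?powR_ge0 // ltW.
have p_le1 : p <= 1.
  rewrite -[leRHS]mulr1 ler_pM ?powR_ge0 ?(ltW c_gt0) //.
  by rewrite -[leRHS](powRr0 n%:R) ler_powR // oppr_le0 divr_ge0 ?ler0n.
apply: le_trans (ex_sparse_ge n r t d (p := p) _); last by rewrite p_ge0.
have -> : c / (2 * A) * n%:R `^ (r%:R - d%:R / (d + t)%:R) =
    p * n%:R ^+ r * (2 * A)^-1.
  rewrite powRD; last by apply/implyP => _; rewrite pnatr_eq0; lia.
  by rewrite powR_mulrn // /p; ring.
have bad_le : \sum_(j < d.+1)
    (n ^ (r + j) * 2 ^ (2 ^ (r + d)))%:R * p ^+ (j + t).+1 <=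
    p * n%:R ^+ r * (2 * A)^-1.
  have bad_j (j : 'I_d.+1) : true ->
      (n ^ (r + j) * 2 ^ (2 ^ (r + d)))%:R * p ^+ (j + t).+1 <=
      p * n%:R ^+ r * M * c.
    move=> _; rewrite natrM natrX exprS exprD -ME.
    have := powR_density (d := d) (t := t) (c := c) (j := j) _ n_gt0 t_gt0 _.
    rewrite c_gt0 c_le1 -ltnS ltn_ord => /(_ isT isT) cj.
    have regroup (x y z u v : R) : x * y * z * (u * v) = u * x * z * (y * v).
      by ring.
    rewrite regroup.
    apply: ler_wpM2l cj.
    exact: mulr_ge0 (mulr_ge0 p_ge0 (exprn_ge0 r n0)) (le_trans ler01 M1).
  apply: le_trans (ler_sum _ bad_j) _.
  rewrite sumr_const card_ord -mulr_natl /c le_eqVlt; apply/orP; left; apply/eqP.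
  field; rewrite -natr1 in d1; lra.
have good_ge : p * n%:R ^+ r * A^-1 <= p * 'C(n, r)%:R.
  rewrite -mulrA ler_wpM2l // ler_pdivrMr ?(lt_le_trans ltr01) //.
  by rewrite AE -natrX -natrM ler_nat mulnC bin_ge_expn.
apply: le_trans (lerB good_ge bad_le).
rewrite le_eqVlt; apply/orP; left; apply/eqP; field; lra.
Qed.

(** * The lower bound on the extremal number *)

Local Open Scope classical_set_scope.

Theorem theorem3 (R : realType) (r k : nat) (q : int)
    (hr : (2 <= r)%N)
    (hq : - r%:Z + 1 <= q)
    (hk : r%:Z + q + 1 <= k%:Z) :
  let f := fun n : nat => (ex n (@family_H r k q))%:R : R in
  let g1 := fun n : nat =>
    n%:R `^ (r%:R - 1 + (q%:~R + r%:R) / (k%:R - 1)) : R in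
  let g2 := fun n : nat =>
    n%:R `^ ((k%:R * r%:R - k%:R + q%:~R + 1) / (k%:R - 1)) : R in
  (f \is 'Omega_\oo g1) /\
  (forall u : nat -> R, (u \is 'Omega_\oo g1) <-> (u \is 'Omega_\oo g2)).
Proof.
have [t qE] : exists t : nat, q = t%:Z - r%:Z.
  by exists (absz (q + r%:Z)); lia.
have [d kE] : exists d : nat, k = (d + t).+1 by exists (k - t.+1)%N; lia.
have t_gt0 : (0 < t)%N by lia.
move: hq hk => _ _; rewrite {}qE {}kE.
have k1 : (d + t).+1%:R - 1 = (d + t)%:R :> R by rewrite -natr1 addrK.
have k1_gt0 : 0 < (d + t)%:R :> R by rewrite ltr0n addn_gt0 t_gt0 orbT.
have qr : (t%:Z - r%:Z)%:~R + r%:R = t%:R :> R by rewrite intrB subrK.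
move=> f g1 g2; split; last first.
  suff -> : g1 = g2 by [].
  apply/funext => n; congr (_ `^ _); rewrite qr k1.
  by rewrite intrB -natr1 natrD in k1_gt0 *; field; lra.
have [a a_gt0 exa] := ex_ge R r d t_gt0.
apply/asboolP; exists a => //.
near=> n; rewrite /f /g1 qr k1.
rewrite [leLHS](_ : _ = a * n%:R `^ (r%:R - d%:R / (d + t)%:R)); last first.
  rewrite ger0_norm ?powR_ge0 //; congr (_ * _ `^ _).
  by rewrite natrD in k1_gt0 *; field; lra.
rewrite ger0_norm ?ler0n //; apply: exa.
- near: n; exact: nbhs_infty_ge.
- near: n; exact: nbhs_infty_gt.
Unshelve. all: by end_near.
Qed.
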